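(* Let $Q\in\mathcal B$ and $0<\alpha<1$. Then $$\left.\frac{d_+}{d_+x}\mathcal J_x(\Lambda,\phi_0)(Q)\right|_{x=\alpha}=\Pi_\alpha(Q)=\lim_{x\to\alpha,\ x>\alpha}\Pi_x(Q)=\lim_{x\to\alpha,\ x>\alpha}\Theta_x(Q),$$ where $d_+/d_+x$ denotes the right derivative. Also, $$\lim_{x\to\alpha,\ x<\alpha}\Pi_x(Q)=\Theta_\alpha(Q).$$
   Context: Setting. Let $X$ be a set, $S:X\to X$ a bijection, $\mathcal A$ a $\sigma$-algebra on $X$, $\mathcal A_0$ the $\sigma$-algebra generated by $\bigcup_{i\ge 0}S^{-i}\mathcal A$, $\mathcal B$ the $\sigma$-algebra generated by $\bigcup_{i\in\mathbb Z}S^{-i}\mathcal A$, and $\mathcal A_m:=S^{-m}\mathcal A_0=\{S^{-m}A:A\in\mathcal A_0\}$ for integers $m\le 0$ (so $\mathcal A_0\subset\mathcal A_{-1}\subset\cdots$). Let $\phi_0$ be a finite positive measure on $\mathcal A_0$, and $\Lambda$ a finite positive measure on $\mathcal A_0$ with $\Lambda\circ S^{-1}=\Lambda$ and $\Lambda\ll\phi_0$; let $Z\ge0$ be an $\mathcal A_0$-measurable version of $d\Lambda/d\phi_0$. For $Q\subset X$ let $\mathcal C(Q)$ be the set of all sequences $(A_m)_{m\le0}$ with $A_m\in\mathcal A_m$ for all $m\le 0$ and $Q\subset\bigcup_{m\le0}A_m$. Define $\Phi(Q):=\inf_{(A_m)\in\mathcal C(Q)}\sum_{m\le0}\phi_0(S^mA_m)$.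 The symbol $\Lambda$ also denotes $\Lambda(Q):=\inf_{(A_m)\in\mathcal C(Q)}\sum_{m\le0}\Lambda(S^mA_m)$, $Q\subset X$; its restriction to $\mathcal B$ is the unique $S$-invariant measure on $\mathcal B$ extending $\Lambda$. Conventions: $0\log0:=0$, $y^x:=e^{x\log y}$ and thus $0^0:=1$; $Z^\alpha\log Z:=0$ where $Z=0$ ($\alpha>0$). For $\epsilon>0$: $\mathcal C^1_\epsilon(Q):=\{(A_m)\in\mathcal C(Q):\sum_{m\le0}\Lambda(S^mA_m)<\Lambda(Q)+\epsilon\}$; $\mathcal C^{0,1}_\epsilon(Q):=\{(A_m)\in\mathcal C^1_\epsilon(Q):\sum_{m\le0}\phi_0(S^mA_m)<\Phi^{\Lambda}(Q)+\epsilon\}$, where $\Phi^{\Lambda}(Q):=\lim_{\epsilon\to0}\inf_{(A_m)\in\mathcal C^1_\epsilon(Q)}\sum_{m\le0}\phi_0(S^mA_m)$ (which equals $\Phi(Q)$). For $\alpha\ge0$: $\mathcal J_\alpha(\Lambda,\phi_0)(Q):=\lim_{\epsilon\to0}\sup_{(A_m)\in\mathcal C^{0,1}_\epsilon(Q)}\sum_{m\le0}\int_{S^mA_m}Z^\alpha d\phi_0$. For $0<\alpha\le1$: $\mathcal F^{\alpha,0,1}_\epsilon(Q):=\{(A_m)\in\mathcal C^{0,1}_\epsilon(Q):\sum_{m\le0}\int_{S^mA_m}Z^\alpha d\phi_0>\mathcal J_\alpha(\Lambda,\phi_0)(Q)-\epsilon\}$, $\Theta_\alpha(Q):=\lim_{\epsilon\to0}\inf_{(A_m)\in\mathcal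 F^{\alpha,0,1}_\epsilon(Q)}\sum_{m\le0}\int_{S^mA_m}Z^\alpha\log Z\,d\phi_0$ and $\Pi_\alpha(Q):=\lim_{\epsilon\to0}\sup_{(A_m)\in\mathcal F^{\alpha,0,1}_\epsilon(Q)}\sum_{m\le0}\int_{S^mA_m}Z^\alpha\log Z\,d\phi_0$. *)

(* Defs.v *)
From HB Require Import structures.
From mathcomp Require Export all_boot all_order all_algebra.
From mathcomp Require Export all_classical all_reals all_analysis.
Export Order.TTheory GRing.Theory Num.Theory.
Export numFieldNormedType.Exports.

Set Implicit Arguments.
Unset Strict Implicit.
Unset Printing Implicit Defensive.

Local Open Scope classical_set_scope.
Local Open Scope ring_scope.
Local Open Scope ereal_scope.

(* The given sigma-algebra calA is [measurable : set (set X)].  The indices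
   m <= 0 are encoded as m = - n with n : nat, so that a sequence (A_m)_{m <= 0}
   is a function A : nat -> set X whose value A n is A_{-n}. *)

(* The set S^i B, for S bijective and i in Z. *)
Definition zimage (X : Type) (S : X -> X) (i : int) (B : set X) : set X :=
  match i with
  | Posz n => iter n S @` B
  | Negz n => iter n.+1 S @^-1` B
  end.

(* The family \bigcup_{i >= 0} S^{-i} calA, which generates calA_0. *)
Definition gen0 d (X : measurableType d) (S : X -> X) : set (set X) :=
  \bigcup_(i : nat) [set zimage S (- i%:Z)%R B | B in (measurable : set (set X))].

(* X equipped with the sigma-algebra calA_0. *)
Notation space0 S := (g_sigma_algebraType (gen0 S)).

(* [past S n] is calA_{-n} = S^n calA_0. *)
Definition past d (X : measurableType d) (S : X -> X) (n : nat) : set (set X) :=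
  [set zimage S n%:Z B | B in <<s gen0 S >>].

Definition calB d (X : measurableType d) (S : X -> X) : set (set X) :=
  <<s \bigcup_(i : int)
        [set zimage S (- i)%R B | B in (measurable : set (set X))] >>.

Definition cover d (X : measurableType d) (S : X -> X) (Q : set X) :
    set (nat -> set X) :=
  [set A | (forall n, past S n (A n)) /\ Q `<=` \bigcup_n A n].

(* \sum_{m <= 0} f (S^m A_m) *)
Definition shift_sum (R : realType) (X : Type) (S : X -> X)
    (f : set X -> \bar R) (A : nat -> set X) : \bar R :=
  \sum_(0 <= n <oo) f (zimage S (- n%:Z)%R (A n)).

(* Z is a finite nonnegative version of the Radon-Nikodym derivative
   d nu / d mu. *)
Definition is_density d (T : measurableType d) (R : realType)
    (nu mu : set T -> \bar R) (Z : T -> R) : Prop :=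
  [/\ measurable_fun [set: T] Z, (forall x, (0 <= Z x)%R) &
      forall B, measurable B -> nu B = \int[mu]_(x in B) (Z x)%:E].

(* f has the (finite) right derivative l at a.  Since l is finite, the
   convergence forces f a, and f (a + h) for small h > 0, to be finite. *)
Definition is_right_derive (R : realType) (f : R -> \bar R) (a : R)
    (l : \bar R) : Prop :=
  l \is a fin_num /\
  (h^-1)%:E * (f (a + h)%R - f a) @[h --> (0%R : R)^'+] --> l.

Section functionals.
Context d (X : measurableType d) (R : realType) (S : X -> X).
Context (phi0 Lambda : {finite_measure set (space0 S) -> \bar R}).
Context (Z : space0 S -> R).
Implicit Types (Q : set X) (a e : R) (A : nat -> set X).

Definition Lambda_ext Q : \bar R :=
  ereal_inf [set shift_sum S Lambda A | A in cover S Q].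

Definition C1 e Q : set (nat -> set X) :=
  [set A | cover S Q A /\ shift_sum S Lambda A < Lambda_ext Q + e%:E].

Definition PhiLambda Q : \bar R :=
  lim (ereal_inf [set shift_sum S phi0 A | A in C1 e Q] @[e --> (0%R : R)^'+]).

Definition C01 e Q : set (nat -> set X) :=
  [set A | C1 e Q A /\ shift_sum S phi0 A < PhiLambda Q + e%:E].

(* \sum_{m <= 0} \int_{S^m A_m} Z^a d phi0.  The library's [powR] satisfies
   0 `^ 0 = 1 and 0 `^ a = 0 for a != 0. *)
Definition pow_sum a A : \bar R :=
  shift_sum S (fun B => \int[phi0]_(x in B) (Z x `^ a)%:E) A.

(* \sum_{m <= 0} \int_{S^m A_m} Z^a log Z d phi0, for a > 0.  The integrand
   vanishes where Z = 0, since then Z `^ a = 0. *)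
Definition powlog_sum a A : \bar R :=
  shift_sum S (fun B => \int[phi0]_(x in B) (Z x `^ a * ln (Z x))%:E) A.

Definition J a Q : \bar R :=
  lim (ereal_sup [set pow_sum a A | A in C01 e Q] @[e --> (0%R : R)^'+]).

Definition F01 a e Q : set (nat -> set X) :=
  [set A | C01 e Q A /\ J a Q - e%:E < pow_sum a A].

Definition Theta a Q : \bar R :=
  lim (ereal_inf [set powlog_sum a A | A in F01 a e Q] @[e --> (0%R : R)^'+]).

Definition Pi a Q : \bar R :=
  lim (ereal_sup [set powlog_sum a A | A in F01 a e Q] @[e --> (0%R : R)^'+]).

End functionals.

(* Main.v *)
Require Import Defs.
From mathcomp Require Import all_boot all_order all_algebra.
From mathcomp Require Import all_classical all_reals all_analysis.
From mathcomp Require Import measurable_realfun ring lra.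
Import Order.TTheory GRing.Theory Num.Theory.
Local Open Scope classical_set_scope.
Local Open Scope ring_scope.

(** For a cover [A] write [B_n = S^{-n} A_n].  The function
    [f_A x = \sum_n \int_{B_n} Z^x d phi0] is convex with derivative [g_A]
    given by [Z^x log Z], and on compact subintervals of (0, 1) its second order
    Taylor remainder is bounded uniformly in [A], because
    [Z^x (log Z)^2 <= K (1 + Z)] and the sums of [phi0] and [Lambda] are bounded.
    [J] is the upper envelope of the [f_A] along the shrinking classes of covers,
    and the uniform remainder turns near-maximality of [A] into two-sided bounds:
    [Pi_x <= (J y - J x) / (y - x) <= Theta_y <= Pi_y] for [x < y], while the
    slope at the right of [x] is at most [Pi_x + e].  All four limits follow.

    The classes of covers are nonempty, and [Phi^Lambda (Q)] is finite, because a
    cover can be rearranged, without increasing its [Lambda]-cost, so that its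
    [phi0]-cost is at most [phi0 X + 1]. *)

(** * Upper envelopes of families with a uniform Taylor bound *)

(** For classes [H r] that shrink with [r], this is convergence to [l] of the suprema of [h] over
    [H r] as [r] decreases to 0, phrased with real numbers only. The second clause also makes every
    [H r] with [0 < r] nonempty. Infima are treated through [- h] and [- l]. *)
Definition is_limsup {R : realType} {T : Type} (H : R -> set T) (h : T -> R)
    (l : R) : Prop :=
  (forall e, 0 < e -> exists2 r, 0 < r & forall A, H r A -> h A < l + e) /\
  (forall e r, 0 < e -> 0 < r -> exists2 A, H r A & l - e < h A).

Section envelope.
Context {R : realType} {T : Type} (G : R -> set T) (f g : R -> T -> R).
Context (J P Q : R -> R) (a b : R).
Context (subG : forall r s, 0 < r -> r <= s -> G r `<=` G s).
Context (tangent : forall A x y, G 1 A -> a < x < b -> a < y < b ->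
  f x A + (y - x) * g x A <= f y A).
Context (taylor : forall c d, a < c -> c < d -> d < b -> exists2 K, 0 < K &
  forall A x y, G 1 A -> c <= x <= d -> c <= y <= d ->
    f y A <= f x A + (y - x) * g x A + K * (y - x) ^+ 2 /\ `|g x A| <= K).
Let F x r : set T := [set A | G r A /\ J x - r < f x A].
Context (limsupJ : forall x, a < x < b -> is_limsup G (f x) (J x)).
Context (limsupP : forall x, a < x < b -> is_limsup (F x) (g x) (P x)).
Context (liminfQ : forall x, a < x < b ->
  is_limsup (F x) (fun A => - g x A) (- Q x)).

Let subF x r s : 0 < r -> r <= s -> F x r `<=` F x s.
Proof. by move=> r0 rs A [GA fA]; split; [exact: subG GA|lra]. Qed.

(** Take [A] nearly maximal at [x] with [g x A] close to [P x]. The tangent at [x] lies below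
    [f y A], which exceeds [J y] by little once [A] is in a small class [G r]. *)
Lemma slope_ge_envelope x y : a < x -> x < y -> y < b ->
  (y - x) * P x <= J y - J x.
Proof.
move=> ax xy yb; apply/ler_addgt0Pr => e e0.
(* Two errors [e1] come from the values of [f] at [x] and [y], and an error [(y - x) * e1] from
   [g x A]. *)
pose e1 := e / (2 + (y - x)).
have D0 : 0 < 2 + (y - x) by lra.
have e10 : 0 < e1 by exact: divr_gt0.
have eE : e = e1 * 2 + e1 * (y - x) by rewrite /e1 -mulrDr mulfVK// gt_eqF.
have [//|r r0 rP] := (limsupJ y _).1 _ e10; first by apply/andP; split; lra.
(* The three bounds put [A] in [G r], within [e1] of [J x], and in [G 1], where the tangent
   inequality holds. *)
pose s := Num.min (Num.min r e1) 1.
have s0 : 0 < s by rewrite !lt_min r0 e10 ltr01.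
have [|A [GA fA] gA] := (limsupP x _).2 _ _ e10 s0.
  by apply/andP; split; lra.
have fy : f y A < J y + e1 by apply: rP; apply: subG GA; rewrite // !ge_min lexx.
have sle : s <= e1 by rewrite !ge_min lexx orbT.
have := tangent A x y; have s1 : s <= 1 by rewrite ge_min lexx orbT.
move=> /(_ (subG _ _ s0 s1 _ GA)) => /(_ ltac:(lra) ltac:(lra)).
have : (y - x) * (P x - e1) <= (y - x) * g x A by rewrite ler_wpM2l; lra.
lra.
Qed.

(** Here the tangent is taken at [y], for an [A] nearly maximal at [y] with [g y A] close to [Q y],
    and is followed back to [x]. *)
Lemma slope_le_envelope x y : a < x -> x < y -> y < b ->
  J y - J x <= (y - x) * Q y.
Proof.
move=> ax xy yb; apply/ler_addgt0Pr => e e0.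
pose e1 := e / (2 + (y - x)).
have D0 : 0 < 2 + (y - x) by lra.
have e10 : 0 < e1 by exact: divr_gt0.
have eE : e = e1 * 2 + e1 * (y - x) by rewrite /e1 -mulrDr mulfVK// gt_eqF.
have [//|r r0 rP] := (limsupJ x _).1 _ e10; first by apply/andP; split; lra.
pose s := Num.min (Num.min r e1) 1.
have s0 : 0 < s by rewrite !lt_min r0 e10 ltr01.
have [|A [GA fA] gA] := (liminfQ y _).2 _ _ e10 s0.
  by apply/andP; split; lra.
have fx : f x A < J x + e1 by apply: rP; apply: subG GA; rewrite // !ge_min lexx.
have sle : s <= e1 by rewrite !ge_min lexx orbT.
have := tangent A y x; have s1 : s <= 1 by rewrite ge_min lexx orbT.
move=> /(_ (subG _ _ s0 s1 _ GA)) => /(_ ltac:(lra) ltac:(lra)).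
have : (y - x) * g y A <= (y - x) * (Q y + e1) by rewrite ler_wpM2l; lra.
lra.
Qed.

Lemma inf_le_sup_envelope x : a < x < b -> Q x <= P x.
Proof.
move=> axb; apply/ler_addgt0Pr => e e0; have e20 : 0 < e / 2 by lra.
have [r r0 rQ] := (liminfQ x axb).1 _ e20.
have [s s0 sP] := (limsupP x axb).1 _ e20.
have t0 : 0 < Num.min r s by rewrite lt_min r0 s0.
have [A FA _] := (limsupP x axb).2 _ _ e20 t0.
have /= := rQ A (subF _ _ _ t0 _ _ FA); rewrite ge_min lexx => /(_ isT).
by have /= := sP A (subF _ _ _ t0 _ _ FA); rewrite ge_min lexx orbT => /(_ isT); lra.
Qed.

(** Uniformity of [K] in [A] enters here: for [y] close to [x], an [A] nearly maximal at [y] is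
    nearly maximal at [x] too, so [g x A] cannot exceed [P x] by much, and the Taylor bound controls
    [f y A - f x A]. *)
Lemma right_slope_near x e : a < x < b -> 0 < e -> exists2 r, 0 < r &
  forall y, x < y <= x + r -> a < y < b /\ J y - J x <= (y - x) * (P x + e).
Proof.
(* Four errors share [e]: the gap from [f y A] to [J y], the excess of [f x A] over [J x], the
   excess of [g x A] over [P x], and the Taylor remainder. *)
move=> axb e0; have /andP[ax xb] := axb; have e40 : 0 < e / 4 by lra.
pose d := (x + b) / 2.
have [|||K K0 KP] := taylor ((a + x) / 2) d; rewrite ?/d; [lra..|].
have [r r0 rP] := (limsupP x axb).1 _ e40.
pose s := Num.min r 1.
have s0 : 0 < s by rewrite lt_min r0 ltr01.
have [sr s1] : s <= r /\ s <= 1 by split; rewrite ge_min lexx ?orbT.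
(* With [h = y - x], the product [h * M] bounds the near-maximality that [A] loses from [y] back to
   [x]. The bounds in [t] keep [y] below [b], this loss below [s], and [h * K] below [e / 4]. *)
pose M := K + `|P x| + e.
have M0 : 0 < M by rewrite /M; have := normr_ge0 (P x); lra.
pose t := Num.min ((b - x) / 2) (Num.min (s / M) (e / 4 / K)).
have t0 : 0 < t by rewrite !lt_min !divr_gt0//; lra.
have [tb tM tK] : [/\ t <= (b - x) / 2, t * M <= s & t * K <= e / 4].
  by split; rewrite -?ler_pdivlMr// !ge_min lexx ?orbT.
exists t => // y /andP[xy yt]; split; first by lra.
pose h := y - x.
have h0 : 0 < h by rewrite /h; lra.
have ht : h <= t by rewrite /h; lra.
have hM : h * M <= s by rewrite (le_trans _ tM)// ler_wpM2r// ltW.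
have hK : h * K <= e / 4 by rewrite (le_trans _ tK)// ler_wpM2r// ltW.
have he0 : 0 < h * (e / 4) by exact: mulr_gt0.
(* The tolerance is proportional to [h], since a difference quotient of step [h] is being
   estimated. *)
have [u u0 uP] := (limsupJ x axb).1 _ he0.
pose v := Num.min u s.
have v0 : 0 < v by rewrite lt_min u0 s0.
have [vu vs] : v <= u /\ v <= s by split; rewrite ge_min lexx ?orbT.
have [|A GA fA] := (limsupJ y _).2 _ _ he0 v0; first by lra.
have G1A : G 1 A by apply: subG GA => //; lra.
have cxd : (a + x) / 2 <= x <= d by rewrite /d; lra.
have cyd : (a + x) / 2 <= y <= d by rewrite /d; lra.
have [fy _] := KP A x y G1A cxd cyd.
have [_] := KP A y x G1A cyd cxd; rewrite ler_norml => /andP[_ gy].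
have fx := uP A (subG _ _ v0 vu _ GA).
have Jge := slope_ge_envelope x y ltac:(lra) xy ltac:(lra).
have hgK : h * g y A <= h * K by rewrite ler_pM2l.
have tg := tangent A y x G1A ltac:(lra) ltac:(lra).
have hP : - (h * `|P x|) <= h * P x.
  by rewrite -mulrN ler_pM2l// lerNl -normrN ler_norm.
(* Following the tangent at [y] back to [x], and using [J y >= J x + h * P x], shows that [A] falls
   short of [J x] by less than [h * M <= s], so [A] lies in [F x s]. *)
have gx : g x A < P x + e / 4.
  apply: rP; apply: (subF _ _ _ s0 sr); split.
    by apply: (subG _ _ v0 vs).
  rewrite /M !mulrDr in hM; rewrite -/h in Jge.
  have : x - y = - h by rewrite /h; ring.
  move=> xyE; rewrite xyE in tg; nra.
rewrite -/h in fy Jge *.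
have : h * g x A <= h * (P x + e / 4) by rewrite ler_pM2l// ltW.
have : K * h ^+ 2 <= h * (e / 4).
  by rewrite expr2 mulrA (mulrC _ h) ler_pM2l// mulrC.
lra.
Qed.

(** Lower bounds come from the slope over [[x, y]]. The upper bound on [P y] comes from the slope
    over [[y, x + r]], which the estimates based at [x] keep close to [P x]; then [Q y <= P y]
    bounds [Q y]. *)
Lemma right_envelope_near x e : a < x < b -> 0 < e -> exists2 r, 0 < r &
  forall y, x < y < x + r ->
  [/\ (y - x) * P x <= J y - J x <= (y - x) * (P x + e),
      P x <= Q y <= P x + e & P x <= P y <= P x + e].
Proof.
move=> axb e0; have /andP[ax xb] := axb; have e20 : 0 < e / 2 by lra.
have [r r0 rP] := right_slope_near x (e / 2) axb e20.
(* For [y < x + r / 2] the error [r * (e / 2)] is at most [(x + r - y) * e]. *)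
exists (r / 2); first by lra.
move=> y /andP[xy yr]; have [ayb Jy] := rP y ltac:(lra).
have [azb Jz] := rP (x + r) ltac:(lra).
have Jxy := slope_ge_envelope x y ltac:(lra) xy ltac:(lra).
have Jyz := slope_ge_envelope y (x + r) ltac:(lra) ltac:(lra) ltac:(lra).
have JQ := slope_le_envelope x y ltac:(lra) xy ltac:(lra).
have QP := inf_le_sup_envelope y ayb.
have PQ : P x <= Q y by rewrite -(@ler_pM2l _ (y - x))//; lra.
have PP : P y <= P x + e by rewrite -(@ler_pM2l _ (x + r - y))//; nra.
split; [nra|lra..].
Qed.

End envelope.

Lemma cvg_at_right_of_near {R : realType} (k : R -> R) (a l : R) :
  (forall e, 0 < e -> exists2 r, 0 < r & forall y, a < y < a + r ->
    `|l - k y| <= e) ->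
  k y @[y --> a^'+] --> l.
Proof.
move=> H; apply/cvgrPdist_le => e e0; have [r r0 rP] := H e e0; near=> y.
apply: rP; apply/andP; split; near: y; first exact: nbhs_right_gt.
by apply: nbhs_right_lt; rewrite ltrDl.
Unshelve. all: by end_near. Qed.

(* The left limit is the right limit for the family reflected by [x |-> - x],
   which exchanges [P] with [- Q]. *)
Lemma envelope_derivatives {R : realType} {T : Type} (G : R -> set T)
    (f g : R -> T -> R) (J P Q : R -> R) (a b : R) :
  (forall r s, 0 < r -> r <= s -> G r `<=` G s) ->
  (forall A x y, G 1 A -> a < x < b -> a < y < b ->
    f x A + (y - x) * g x A <= f y A) ->
  (forall c d, a < c -> c < d -> d < b -> exists2 K, 0 < K &
    forall A x y, G 1 A -> c <= x <= d -> c <= y <= d ->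
      f y A <= f x A + (y - x) * g x A + K * (y - x) ^+ 2 /\ `|g x A| <= K) ->
  (forall x, a < x < b -> is_limsup G (f x) (J x)) ->
  (forall x, a < x < b ->
    is_limsup (fun r => [set A | G r A /\ J x - r < f x A]) (g x) (P x)) ->
  (forall x, a < x < b ->
    is_limsup (fun r => [set A | G r A /\ J x - r < f x A])
      (fun A => - g x A) (- Q x)) ->
  forall x, a < x < b ->
  [/\ h^-1 * (J (x + h) - J x) @[h --> 0^'+] --> P x,
      P y @[y --> x^'+] --> P x, Q y @[y --> x^'+] --> P x &
      P y @[y --> x^'-] --> Q x].
Proof.
move=> subG tangent taylor limsupJ limsupP liminfQ x axb.
have R_near e (e0 : 0 < e) :=
  @right_envelope_near R T G f g J P Q a b subG tangent taylor limsupJ limsupP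
    liminfQ x e axb e0.
have L_near e (e0 : 0 < e) : exists2 r, 0 < r &
    forall y, x - r < y < x -> Q x - e <= P y <= Q x.
  have [||||||r r0 rP] := @right_envelope_near R T G
    (fun y A => f (- y) A) (fun y A => - g (- y) A) (J \o -%R)
    (fun y => - Q (- y)) (fun y => - P (- y)) (- b) (- a) subG
    _ _ _ _ _ (- x) e _ e0.
  - move=> A y z GA yb zb.
    have := tangent A (- y) (- z) GA ltac:(lra) ltac:(lra); lra.
  - move=> c d bc cd da.
    have [||| K K0 KP] := taylor (- d) (- c); [lra..|exists K => // A y z GA ycd zcd].
    have := KP A (- y) (- z) GA ltac:(lra) ltac:(lra).
    have -> : - z - - y = - (z - y) by ring.
    by rewrite sqrrN mulNr mulrN normrN.
  - by move=> y yb; apply: limsupJ; lra.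
  - by move=> y yb; apply: liminfQ; lra.
  - move=> y yb; rewrite (_ : (fun A => - - g (- y) A) = g (- y)); last first.
      by apply/funext => A; rewrite opprK.
    by rewrite opprK; apply: limsupP; lra.
  - lra.
  (* The clause on [Q] for the reflected family is the bound on [P] at the left of [x]. *)
  exists r => // y yr; have [_ + _] := rP (- y) ltac:(lra).
  by rewrite !opprK; lra.
split.
- apply: cvg_at_right_of_near => e e0; have [r r0 rP] := R_near e e0.
  exists r => // h; rewrite add0r => /andP[h0 hr].
  have [+ _ _] := rP (x + h) ltac:(lra).
  rewrite (_ : x + h - x = h); last by ring.
  by rewrite -(ler_pdivlMl _ _ h0) -(ler_pdivrMl _ _ h0) distrC ler_distl; lra.
- apply: cvg_at_right_of_near => e e0; have [r r0 rP] := R_near e e0.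
  by exists r => // y /rP[_ _ ?]; rewrite distrC ler_distl; lra.
- apply: cvg_at_right_of_near => e e0; have [r r0 rP] := R_near e e0.
  by exists r => // y /rP[_ ? _]; rewrite distrC ler_distl; lra.
- apply/cvg_at_leftNP; apply: cvg_at_right_of_near => e e0.
  have [r r0 rP] := L_near e e0; exists r => // y yr /=.
  by have ? := rP (- y) ltac:(lra); rewrite distrC ler_distl; lra.
Qed.

(** * Limits of suprema over shrinking families *)

(** The suprema are nondecreasing in [r], so they converge to their infimum over []0, 1]], which is
    finite by nonemptiness and the bound [M] on [H 1]. *)
Lemma cvg_ereal_sup_family {R : realType} {T : Type} (H : R -> set T)
    (h : T -> \bar R) (k : T -> R) (M : R) :
  (forall r s, 0 < r -> r <= s -> H r `<=` H s) ->
  (forall r, 0 < r -> H r !=set0) ->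
  (forall A, H 1 A -> h A = (k A)%:E /\ `|k A| <= M) ->
  exists2 l : R, ereal_sup [set h A | A in H r] @[r --> 0^'+] --> l%:E &
    is_limsup H k l.
Proof.
move=> subH H0 hk; pose F r := ereal_sup [set h A | A in H r].
have Fle r s : 0 < r -> r <= s -> (F r <= F s)%E.
  by move=> r0 rs; apply: le_ereal_sup => _ [A HA <-]; exists A => //; exact: subH HA.
have := @nondecreasing_at_right_cvge R F 0 (BRight 1).
rewrite bnd_simp ltr01 => /(_ isT).
have ndF : {in `]0%R, 1%R] &, {homo F : x y / x <= y >-> (x <= y)%E}}.
  by move=> x y; rewrite !in_itv/= => /andP[x0 _] _; exact: Fle.
move=> /(_ ndF); set L := ereal_inf _ => FL.
have LF r : 0 < r -> r <= 1 -> (L <= F r)%E.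
  by move=> r0 r1; apply: ereal_inf_lbound; exists r => //=; rewrite in_itv/= r0.
have Fge r : 0 < r -> r <= 1 -> ((- M)%:E <= F r)%E.
  move=> r0 r1; have [A HA] := H0 r r0.
  have [hA] := hk A (subH _ _ r0 r1 _ HA); rewrite ler_norml => /andP[MA _].
  apply: (@le_trans _ _ (h A)); first by rewrite hA lee_fin.
  by apply: ereal_sup_ubound; exists A.
have Lfin : L \is a fin_num.
  rewrite fin_numE; apply/andP; split.
    rewrite -ltNye; apply: (@lt_le_trans _ _ (- M)%:E); first exact: ltNyr.
    apply/ereal_infP => y [r /=]; rewrite in_itv/= => /andP[r0 r1] <-.
    exact: Fge.
  rewrite -ltey; apply: (@le_lt_trans _ _ M%:E); last exact: ltry.
  apply: (le_trans (LF 1 ltr01 (lexx _))); apply: ge_ereal_sup => _ [A HA <-].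
  by have [->] := hk A HA; rewrite lee_fin ler_norml => /andP[].
exists (fine L); rewrite ?fineK//; split=> [e e0|e r e0 r0].
  have : (L < L + e%:E)%E by rewrite lteDl.
  rewrite {1}/L => /ereal_inf_lt[y [r /=]].
  rewrite in_itv/= => /andP[r0 r1] <- Fr.
  exists r => // A HA; rewrite -lte_fin EFinD fineK//.
  apply: le_lt_trans Fr; have [<- _] := hk A (subH _ _ r0 r1 _ HA).
  by apply: ereal_sup_ubound; exists A.
pose s := Num.min r 1.
have s0 : 0 < s by rewrite lt_min r0 ltr01.
have [sr s1] : s <= r /\ s <= 1 by split; rewrite ge_min lexx ?orbT.
have : (L - e%:E < F s)%E.
  by apply: lt_le_trans (LF s s0 s1); rewrite lteBlDr// lteDl.
move=> /ereal_sup_gt[_ [A HA <-] LA]; exists A; first exact: subH HA.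
move: LA; have [-> _] := hk A (subH _ _ s0 s1 _ HA).
by rewrite -lte_fin EFinB fineK.
Qed.

Lemma cvg_ereal_inf_family {R : realType} {T : Type} (H : R -> set T)
    (h : T -> \bar R) (k : T -> R) (M : R) :
  (forall r s, 0 < r -> r <= s -> H r `<=` H s) ->
  (forall r, 0 < r -> H r !=set0) ->
  (forall A, H 1 A -> h A = (k A)%:E /\ `|k A| <= M) ->
  exists2 l : R, ereal_inf [set h A | A in H r] @[r --> 0^'+] --> l%:E &
    is_limsup H (fun A => - k A) (- l).
Proof.
move=> subH H0 hk.
have [|l Hl kl] := @cvg_ereal_sup_family R T H (fun A => - h A)%E
  (fun A => - k A) M subH H0.
  by move=> A /hk[-> kM]; rewrite EFinN normrN.
exists (- l); last by rewrite opprK.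
rewrite EFinN; apply: cvg_trans (cvgeN Hl); apply: near_eq_cvg.
apply: nearW => r /=; rewrite /ereal_inf; congr (- ereal_sup _)%E.
by rewrite image_comp.
Qed.

(** * Powers of the density *)

Lemma expR_sub1_le {R : realType} (t : R) : expR t - 1 - t <= t ^+ 2 * (1 + expR t).
Proof.
(* Convexity gives [t * expR t >= expR t - 1], hence [expR t - 1 - t <= t * (expR t - 1)]. *)
have e1 := expR_ge1Dx t; have e2 := expR_ge1Dx (- t).
have e0 := expR_gt0 t; have ee : expR t * expR (- t) = 1 by rewrite -expRD subrr expR0.
have le1 : expR t - 1 <= t * expR t by nra.
have t2 : 0 <= t ^+ 2 by exact: sqr_ge0.
have [t0|t0] := leP 0 t.
  have : t * (expR t - 1) <= t * (t * expR t) by rewrite ler_wpM2l.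
  nra.
have : t * (expR t - 1) <= t * t by rewrite ler_wnM2l; lra.
nra.
Qed.

Lemma sqr_le_expR {R : realType} (t : R) : 0 <= t -> t ^+ 2 <= 2 * expR t.
Proof.
move=> t0; have := @expR_ge1Dxn R t 1 t0; rewrite (_ : 2`! = 2%N)//; have := expR_ge0 t; lra.
Qed.

(* Uniform over exponents [c] in [[a, b]] inside [(0, 1)]. *)
Lemma sqr_mul_expR_le {R : realType} (a b c u : R) :
  0 < a -> b < 1 -> a <= c <= b ->
  u ^+ 2 * expR (c * u) <= (2 / a ^+ 2 + 2 / (1 - b) ^+ 2) * (1 + expR u).
Proof.
move=> a0 b1 /andP[ac cb].
have a20 : 0 < 2 / a ^+ 2 by rewrite divr_gt0// exprn_gt0.
have b20 : 0 < 2 / (1 - b) ^+ 2 by rewrite divr_gt0// exprn_gt0//; lra.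
have E0 := expR_gt0 u; have C0 := expR_gt0 (c * u).
(* For [u >= 0] the gap [1 - b] between the exponents and 1 absorbs [u ^+ 2]; for [u < 0] the gap
   [a] between 0 and the exponents does. *)
have [u0|u0] := leP 0 u.
  have v0 : 0 <= (1 - b) * u by rewrite mulr_ge0//; lra.
  have := sqr_le_expR _ v0; rewrite exprMn.
  move=> le; have {le} le : u ^+ 2 <= 2 / (1 - b) ^+ 2 * expR ((1 - b) * u).
    rewrite -(@ler_pM2l _ ((1 - b) ^+ 2)) ?exprn_gt0//; last by lra.
    by rewrite [leRHS]mulrA [X in _ <= X * _]mulrC divfK// expf_neq0//; apply/eqP; lra.
  have : u ^+ 2 * expR (c * u) <= 2 / (1 - b) ^+ 2 * expR u.
    apply: le_trans (ler_wpM2r (ltW C0) le) _.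
    rewrite -(mulrA (2 / (1 - b) ^+ 2)) -expRD ler_pM2l// ler_expR; nra.
  nra.
have v0 : 0 <= a * - u by rewrite mulr_ge0//; lra.
have := sqr_le_expR _ v0; rewrite exprMn sqrrN.
move=> le; have {le} le : u ^+ 2 <= 2 / a ^+ 2 * expR (a * - u).
  rewrite -(@ler_pM2l _ (a ^+ 2)) ?exprn_gt0//.
  by rewrite [leRHS]mulrA [X in _ <= X * _]mulrC divfK// expf_neq0//; apply/eqP; lra.
have : u ^+ 2 * expR (c * u) <= 2 / a ^+ 2 * 1.
  apply: le_trans (ler_wpM2r (ltW C0) le) _.
  by rewrite -(mulrA (2 / a ^+ 2)) -expRD ler_pM2l// -[leRHS](@expR0 R) ler_expR; nra.
nra.
Qed.

(** With [u = ln z] this is [1 + v <= expR v] for [v = (y - x) * u], multiplied by [expR (x * u)].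
    At [z = 0] both powers vanish. *)
Lemma powR_tangent {R : realType} (z x y : R) : 0 <= z -> 0 < x -> 0 < y ->
  z `^ x + (y - x) * (z `^ x * ln z) <= z `^ y.
Proof.
rewrite le_eqVlt => /orP[/eqP <-|z0] x0 y0.
  by rewrite !powR0 ?gt_eqF//; lra.
rewrite /powR (gt_eqF z0); set u := ln z.
have -> : y * u = x * u + (y - x) * u by ring.
rewrite expRD; have := expR_ge1Dx ((y - x) * u); have := expR_gt0 (x * u); nra.
Qed.

(** With [u = ln z], [expR_sub1_le] bounds the remainder by [((y - x) * u) ^+ 2] times
    [expR (x * u) + expR (y * u)]. Each exponential times [u ^+ 2] is at most [K * (1 + z)], whence
    the factor 2. *)
Lemma powR_taylor {R : realType} (a b z x y : R) : 0 <= z -> 0 < a -> b < 1 ->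
  a <= x <= b -> a <= y <= b ->
  z `^ y <= z `^ x + (y - x) * (z `^ x * ln z)
    + 2 * (2 / a ^+ 2 + 2 / (1 - b) ^+ 2) * (1 + z) * (y - x) ^+ 2.
Proof.
move=> z0 a0 b1 xab yab; set K := 2 / a ^+ 2 + _.
have K0 : 0 <= K by rewrite addr_ge0// divr_ge0// exprn_ge0//; lra.
move: z0; rewrite le_eqVlt => /orP[/eqP <-|z0].
  have [x0 y0] : 0 < x /\ 0 < y by split; lra.
  rewrite !powR0 ?gt_eqF// mul0r mulr0 !add0r addr0 mulr1.
  by rewrite mulr_ge0 ?sqr_ge0// mulr_ge0.
rewrite /powR (gt_eqF z0); set u := ln z.
have Hx := sqr_mul_expR_le a b x u a0 b1 xab.
have Hy := sqr_mul_expR_le a b y u a0 b1 yab.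
rewrite -/K lnK// in Hx Hy.
have -> : y * u = x * u + (y - x) * u by ring.
have := expR_sub1_le ((y - x) * u).
have yE : expR (y * u) = expR (x * u) * expR ((y - x) * u).
  by rewrite -expRD; congr expR; ring.
rewrite yE in Hy; rewrite expRD; set e := expR (x * u) in Hx Hy *.
set f := expR _ in Hy *; have e0 : 0 < e by exact: expR_gt0.
rewrite -(ler_pM2l e0) exprMn.
have h2 : 0 <= (y - x) ^+ 2 by exact: sqr_ge0.
have := ler_wpM2l h2 Hx; have := ler_wpM2l h2 Hy; nra.
Qed.

Lemma powR_le1D {R : realType} (z x : R) : 0 <= z -> 0 <= x <= 1 ->
  `|z `^ x| <= 1 + z.
Proof.
move=> z0 /andP[x0 x1]; rewrite ger0_norm ?powR_ge0//.
have [z1|z1] := leP z 1.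
  by have := ge0_ler_powR x0 z0 ler01 z1; rewrite powR1; lra.
have := ler_powR (ltW z1) x1; rewrite powRr1//; lra.
Qed.

(** Since [2 * |u| <= 1 + u ^+ 2] for [u = ln z], the bounds on the power and on the power times
    [u ^+ 2] add up. *)
Lemma powR_ln_le {R : realType} (a b z x : R) : 0 <= z -> 0 < a -> b < 1 ->
  a <= x <= b ->
  `|z `^ x * ln z| <= (1 + (2 / a ^+ 2 + 2 / (1 - b) ^+ 2)) * (1 + z).
Proof.
move=> z0 a0 b1 xab; set K := 2 / a ^+ 2 + _.
have K0 : 0 <= K by rewrite addr_ge0// divr_ge0// exprn_ge0//; lra.
have := powR_le1D z x z0 ltac:(lra).
move: z0; rewrite le_eqVlt => /orP[/eqP <- _|z0].
  have x0 : 0 < x by lra.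
  by rewrite powR0 ?gt_eqF// mul0r normr0; nra.
rewrite /powR (gt_eqF z0); set u := ln z.
have Hx := sqr_mul_expR_le a b x u a0 b1 xab; rewrite -/K lnK// in Hx.
have e0 := expR_gt0 (x * u); rewrite normrM [`|expR _|]gtr0_norm// => e1.
have := sqr_ge0 (`|u| - 1); rewrite sqrrB1 real_normK ?num_real//.
nra.
Qed.

(** * Sums of dominated integrals *)

Section dominated_series.
Context {d} {T : measurableType d} {R : realType}.
Context (mu nu : {finite_measure set T -> \bar R}) (Z : T -> R).
Context (dZ : is_density nu mu Z) (B : nat -> set T).
Context (mB : forall n, measurable (B n)) (M : R).
Context (BM : (\sum_(0 <= n <oo) mu (B n) + \sum_(0 <= n <oo) nu (B n) <= M%:E)%E).
Let w n := fine (mu (B n)) + fine (nu (B n)).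

(** The integral of [1 + Z] over [B n] is [mu (B n) + nu (B n)], which is summable by [BM]. *)
Definition dominated (K : R) (h : T -> R) :=
  [/\ 0 <= K, measurable_fun [set: T] h & forall x, `|h x| <= K * (1 + Z x)].

Definition series_int (h : T -> R) : R :=
  limn (series (fun n => \int[mu]_(x in B n) h x)).

Let integrableZ n : mu.-integrable (B n) (EFin \o Z).
Proof.
have [mZ Z0 ZE] := dZ; apply/integrableP; split.
  by apply: measurable_funTS; exact/measurable_EFinP.
rewrite (_ : (\int[mu]_(x in B n) _ = \int[mu]_(x in B n) (Z x)%:E)%E).
  by rewrite -ZE//; have := fin_num_measure nu (B n) (mB n); rewrite ltey_eq => ->.
by apply: eq_integral => x _ /=; rewrite ger0_norm.
Qed.

Let integrable1DZ K n : mu.-integrable (B n) (EFin \o (fun x => K * (1 + Z x))).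
Proof.
rewrite (_ : EFin \o _ = fun x => (K%:E * (1 + (Z x)%:E))%E)//.
apply: integrableZl => //; apply: (@integrableD _ _ _ mu _ _ (cst 1%E)) => //.
  by apply: finite_measure_integrable_cst.
Qed.

Let integrable_dominated n K h : dominated K h ->
  mu.-integrable (B n) (EFin \o h).
Proof.
move=> [K0 mh hK]; apply: le_integrable (integrable1DZ K n) => //.
  by apply: measurable_funTS; exact/measurable_EFinP.
move=> x _ /=; rewrite lee_fin [leRHS]ger0_norm ?hK//.
by have [_ Z0 _] := dZ; rewrite mulr_ge0// addr_ge0.
Qed.

Let int_bound n K h : dominated K h -> `|\int[mu]_(x in B n) h x| <= K * w n.
Proof.
move=> hK; have ih := integrable_dominated n _ _ hK.
have [mZ Z0 ZE] := dZ; case: hK => K0 mh hK.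
apply: le_trans (le_normr_Rintegral (mB n) ih) _.
have := @le_Rintegral _ _ _ mu (B n) (fun x => `|h x|)
  (fun x => K * (1 + Z x)) (mB n) (integrable_norm ih) (integrable1DZ K n).
move=> /(_ (fun x _ => hK x)) => le; apply: (le_trans le).
rewrite RintegralZl//; last first.
  by have := integrable1DZ 1 n; under eq_fun do rewrite /= mul1r.
rewrite RintegralD//; last exact: finite_measure_integrable_cst.
rewrite Rintegral_cst// mul1r ler_wpM2l// lerD2l.
by rewrite /Rintegral -ZE.
Qed.

Let w_ge0 n : 0 <= w n.
Proof. by rewrite addr_ge0// fine_ge0. Qed.

Let series_w_le n : series w n <= M.
Proof.
rewrite -lee_fin; apply: le_trans BM.
rewrite /series /= -sumEFin.
under eq_bigr do rewrite EFinD !fineK ?fin_num_measure//.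
by rewrite big_split/= leeD//; apply: nneseries_lim_ge.
Qed.

Let M_ge0 : 0 <= M.
Proof. by have := series_w_le 0; rewrite /series/= big_geq. Qed.

Let is_cvg_series_w : cvgn (series w).
Proof.
apply: nondecreasing_is_cvgn; first exact: nondecreasing_series.
by exists M => _ [n _ <-].
Qed.

Lemma is_cvg_series_int K h : dominated K h ->
  cvgn (series (fun n => \int[mu]_(x in B n) h x)).
Proof.
move=> hK; have K0 : 0 <= K by case: hK.
apply: normed_cvg; apply: (@series_le_cvg _ _ (fun n => K * w n)) => //.
- by move=> n; exact: normr_ge0.
- by move=> n; rewrite mulr_ge0.
- by move=> n; exact: int_bound.
- exact: (@is_cvg_seriesZ R w K is_cvg_series_w).
Qed.

Lemma norm_series_int_le K h : dominated K h -> `|series_int h| <= K * M.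
Proof.
move=> hK; have K0 : 0 <= K by case: hK.
have le n : `|series (fun n => \int[mu]_(x in B n) h x) n| <= K * M.
  rewrite /series/=; apply: le_trans (ler_norm_sum _ _ _) _.
  apply: le_trans (_ : _ <= \sum_(0 <= i < n) K * w i) _.
    by apply: ler_sum => i _; exact: int_bound.
  by rewrite -mulr_sumr ler_wpM2l// series_w_le.
have ch := is_cvg_series_int _ _ hK.
rewrite ler_norml; apply/andP; split.
  apply: limr_ge => //; apply: nearW => n.
  by have := le n; rewrite ler_norml => /andP[].
apply: limr_le => //; apply: nearW => n.
by have := le n; rewrite ler_norml => /andP[].
Qed.

Lemma eseries_int K h : dominated K h ->
  (\sum_(0 <= n <oo) \int[mu]_(x in B n) (h x)%:E)%E = (series_int h)%:E.
Proof.
move=> hK; rewrite -EFin_lim; last exact: is_cvg_series_int hK.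
apply/congr_lim/funext => n /=; rewrite /series/= -sumEFin.
apply: eq_bigr => i _; rewrite /Rintegral fineK//.
exact: integrable_fin_num (integrable_dominated i _ _ hK).
Qed.

Lemma dominatedD K1 K2 u v : dominated K1 u -> dominated K2 v ->
  dominated (K1 + K2) (fun x => u x + v x).
Proof.
move=> [K10 mu1 uK] [K20 mv vK]; split; first exact: addr_ge0.
  exact: measurable_funD.
move=> x; apply: le_trans (ler_normD _ _) _.
by rewrite mulrDl lerD.
Qed.

Lemma dominatedZ K a u : dominated K u -> dominated (`|a| * K) (fun x => a * u x).
Proof.
move=> [K0 mu1 uK]; split; first by rewrite mulr_ge0.
  by apply: measurable_funM => //; exact: measurable_cst.
by move=> x; rewrite normrM -mulrA ler_wpM2l.
Qed.

(** Two free coefficients let one statement carry both the tangent inequality and the Taylor bound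
    from points to sums of integrals. *)
Lemma series_int_le_comb (u v s t : T -> R) (a b K1 K2 K3 K4 : R) :
  dominated K1 u -> dominated K2 v -> dominated K3 s -> dominated K4 t ->
  (forall x, u x <= v x + a * s x + b * t x) ->
  series_int u <= series_int v + a * series_int s + b * series_int t.
Proof.
move=> uK vK sK tK le.
have aK := dominatedZ _ a _ sK; have bK := dominatedZ _ b _ tK.
have vaK := dominatedD _ _ _ _ vK aK; have allK := dominatedD _ _ _ _ vaK bK.
pose I h : R^o ^nat := fun n => \int[mu]_(x in B n) h x.
have cu := is_cvg_series_int _ _ uK; have cv := is_cvg_series_int _ _ vK.
have cs := is_cvg_series_int _ _ sK; have ct := is_cvg_series_int _ _ tK.
have ca := @is_cvg_seriesZ R _ a cs; have cb := @is_cvg_seriesZ R _ b ct.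
have cva := is_cvg_seriesD cv ca.
have -> : series_int v + a * series_int s + b * series_int t =
    limn (series (I v + a *: I s + b *: I t)).
  by rewrite (lim_seriesD cva cb) (lim_seriesD cv ca) (lim_seriesZ _ cs) (lim_seriesZ _ ct).
apply: lim_series_le => //; first exact: is_cvg_seriesD.
move=> n; have iP := integrable_dominated n.
rewrite [leRHS](_ : _ = \int[mu]_(x in B n) (v x + a * s x + b * t x)).
  by apply: le_Rintegral => //; [exact: iP uK|exact: iP allK].
rewrite RintegralD//; [|exact: iP vaK|exact: iP bK].
rewrite RintegralD//; [|exact: iP vK|exact: iP aK].
by rewrite !RintegralZl//; [exact: iP tK|exact: iP sK].
Qed.

End dominated_series.

(** * Covers *)

Section covers.
Context {d} {X : measurableType d} {R : realType} {S : X -> X}.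
Context (bijS : bijective S).

Lemma iter_bij n : bijective (iter n S).
Proof.
elim: n => [|n IH]; first by exists id.
by apply: (bij_comp bijS IH).
Qed.

Lemma zimageN n (A : set X) : zimage S (- n%:Z) A = iter n S @^-1` A.
Proof. by case: n => [|n] //=; rewrite image_id. Qed.

Lemma pastE n (A : set X) :
  past S n A <-> measurable (iter n S @^-1` A : set (space0 S)).
Proof.
have [g gK Kg] := iter_bij n; split=> [[B mB <-]|mA].
  rewrite (_ : _ @^-1` _ = B)//; apply/seteqP; split=> [x [y By]|x Bx].
    by move=> /(can_inj gK) <-.
  by exists x.
exists (iter n S @^-1` A) => //; apply/seteqP; split=> [_ [y Ay <-]//|x Ax].
by exists (g x); rewrite /= Kg.
Qed.

Lemma shift_sumE (f : set X -> \bar R) (A : nat -> set X) :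
  shift_sum S f A = (\sum_(0 <= n <oo) f (iter n S @^-1` A n))%E.
Proof. by apply: eq_eseriesr => n _; rewrite zimageN. Qed.

Lemma preimage_iterS n (B : set X) :
  S @^-1` (iter n S @^-1` B) = iter n.+1 S @^-1` B.
Proof. by apply/seteqP; split => x /=; rewrite -iterSr. Qed.

(** The preimage under [S] of a generator of index [i] is one of index [i.+1]. *)
Lemma measurable_shift : measurable_fun [set: space0 S] (S : space0 S -> space0 S).
Proof.
apply: (@measurability _ _ (space0 S) (space0 S) setT S (gen0 S)) => //.
move=> _ [_ [i _ [B mB <-]] <-]; apply: sub_sigma_algebra.
by exists i.+1 => //; exists B => //; rewrite setTI !zimageN preimage_iterS.
Qed.

Lemma measurable_iter_shift n (B : set (space0 S)) :
  measurable B -> measurable (iter n S @^-1` B : set (space0 S)).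
Proof.
elim: n B => [//|n IH] B mB.
have := measurable_shift measurableT _ (IH B mB); rewrite setTI.
by rewrite preimage_iterS.
Qed.

Lemma invariant_iter (mu : {finite_measure set (space0 S) -> \bar R}) :
  (forall B : set (space0 S), measurable B -> mu (S @^-1` B) = mu B) ->
  forall n (B : set (space0 S)), measurable B -> mu (iter n S @^-1` B) = mu B.
Proof.
move=> invmu n B mB; elim: n => [//|n IH].
by rewrite -preimage_iterS invmu//; exact: measurable_iter_shift.
Qed.

Lemma preimage_iterB m n (B : set X) : (n <= m)%N ->
  iter m S @^-1` B = iter (m - n) S @^-1` (iter n S @^-1` B).
Proof.
by move=> nm; apply/seteqP; split => x /=; rewrite -iterD subnKC.
Qed.

Lemma past_nondecreasing m n (B : set X) : (n <= m)%N ->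
  past S n B -> past S m B.
Proof.
move=> nm /pastE mB; apply/pastE; rewrite (preimage_iterB _ _ _ nm).
exact: measurable_iter_shift.
Qed.

Lemma past_seqDU (A : nat -> set X) : (forall n, past S n (A n)) ->
  forall n, past S n (seqDU A n).
Proof.
move=> pA n; apply/pastE; rewrite /seqDU setDE preimage_setI -preimage_setC -setDE -bigcup_mkord.
rewrite preimage_bigcup; apply: measurableD; first exact/pastE.
by apply: bigcup_measurable => k /= kn; apply/pastE/past_nondecreasing/pA/ltnW.
Qed.

(** A cover has a single set per level, so all pieces sent to the same level are merged; a level may
    receive none. *)
Let regroup (D : nat -> set X) (m_ : nat -> nat) m :=
  \bigcup_(n in [set n | m_ n = m]) D n.

Let past_regroup D m_ : (forall n, past S n (D n)) -> (forall n, (n <= m_ n)%N) ->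
  forall m, past S m (regroup D m_ m).
Proof.
move=> pD nm m; apply/pastE; rewrite preimage_bigcup.
apply: bigcup_measurable => n /= <-; apply/pastE.
exact: past_nondecreasing (pD n).
Qed.

(** Subadditivity is applied level by level. In the resulting double sum each piece [n] contributes
    only at level [m_ n], so interchanging the sums gives the bound. *)
Let shift_sum_regroup (mu : {finite_measure set (space0 S) -> \bar R}) D m_ :
  (forall n, past S n (D n)) -> (forall n, (n <= m_ n)%N) ->
  (shift_sum S mu (regroup D m_) <=
   \sum_(0 <= n <oo) mu (iter (m_ n) S @^-1` D n))%E.
Proof.
move=> pD nm; rewrite shift_sumE.
pose a m n := (if m_ n == m then mu (iter (m_ n) S @^-1` D n) else 0)%E.
have a0 m n : (0 <= a m n)%E by rewrite /a; case: ifP.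
apply: (@le_trans _ _ (\sum_(0 <= m <oo) \sum_(0 <= n <oo) a m n)%E).
  apply: lee_nneseries => // m _.
  pose F n := if m_ n == m then iter (m_ n) S @^-1` D n else set0 : set (space0 S).
  have -> : (\sum_(0 <= n <oo) a m n = \sum_(0 <= n <oo) mu (F n))%E.
    by apply: eq_eseriesr => n _; rewrite /a /F; case: ifP.
  apply: measure_sigma_subadditive.
  - move=> n; rewrite /F; case: ifP => // _; apply/pastE.
    exact: past_nondecreasing (pD n).
  - exact/pastE/past_regroup.
  - move=> x [n /= nm' Dx]; exists n => //.
    by rewrite /F -nm' eqxx; rewrite -nm' in Dx.
rewrite nneseries_interchange//; apply: lee_nneseries => [n _ _|n _].
  exact: nneseries_ge0.
rewrite (@nneseriesD1 _ _ (m_ n))// /a eqxx eseries0 ?adde0// => i _ /=.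
by rewrite eq_sym => /negbTE ->.
Qed.

Lemma sum_halves n : \sum_(i < n) 2^-1 ^+ i.+1 = 1 - 2^-1 ^+ n :> R.
Proof.
elim: n => [|n IH]; first by rewrite big_ord0 expr0 subrr.
rewrite big_ord_recr /= IH exprS; lra.
Qed.

(* Disjointify the cover and move its [n]-th piece to a level [m_ n >= n] where
   its [phi]-mass is almost minimal.  The first [N] pieces are then no heavier
   than at the common level [N], where they are disjoint. *)
Lemma bounded_cover (Q : set X) (phi lambda : {finite_measure set (space0 S) -> \bar R})
    (A : nat -> set X) :
  (forall B : set (space0 S), measurable B -> lambda (S @^-1` B) = lambda B) ->
  Defs.cover S Q A ->
  exists A', [/\ Defs.cover S Q A', (shift_sum S lambda A' <= shift_sum S lambda A)%E &
    (shift_sum S phi A' <= phi setT + 1)%E].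
Proof.
move=> invl [pA QA]; pose D := seqDU A.
have pD : forall n, past S n (D n) by exact: past_seqDU.
have mD m n : (n <= m)%N -> measurable (iter m S @^-1` D n : set (space0 S)).
  by move=> nm; apply/pastE/(past_nondecreasing _ _ _ nm).
have near_min n : exists m, (n <= m)%N /\ forall k, (n <= k)%N ->
    (phi (iter m S @^-1` D n) <= phi (iter k S @^-1` D n) + (2^-1 ^+ n.+1)%:E)%E.
  pose V := [set phi (iter m S @^-1` D n) | m in [set m | (n <= m)%N]].
  have e0 : 0 < 2^-1 ^+ n.+1 :> R by rewrite exprn_gt0// invr_gt0.
  have Vlb k : (n <= k)%N -> (ereal_inf V <= phi (iter k S @^-1` D n))%E.
    by move=> nk; apply: ereal_inf_lbound; exists k.
  have Vfin : ereal_inf V \is a fin_num.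
    rewrite ge0_fin_numE; last by apply/ereal_infP => _ [m _ <-].
    apply: le_lt_trans (Vlb n (leqnn n)) _.
    by rewrite -ge0_fin_numE// fin_num_measure//; exact: mD.
  have [_ [m /= nm <-] Vm] := lb_ereal_inf_adherent e0 Vfin.
  exists m; split=> // k nk; apply: le_trans (ltW Vm) _.
  by rewrite leeD2r// Vlb.
have [m_ m_P] := choice near_min.
have nm_ n : (n <= m_ n)%N by have [] := m_P n.
exists (regroup D m_); split.
- split; first exact: past_regroup.
  move=> x /QA; rewrite seqDU_bigcup_eq => -[n _ Dx].
  by exists (m_ n) => //; exists n.
- apply: le_trans (shift_sum_regroup _ _ _ pD nm_) _.
  rewrite shift_sumE; apply: lee_nneseries => // n _.
  (* Invariance makes the [lambda]-mass of [D n] independent of its level, and [D n] is contained in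
     [A n]. *)
  rewrite (preimage_iterB _ _ _ (nm_ n)) invariant_iter//; last exact: mD.
  apply: le_measure; rewrite ?inE; [exact: mD|exact/pastE|].
  by apply: preimage_subset; exact: subDsetl.
- apply: le_trans (shift_sum_regroup _ _ _ pD nm_) _.
  apply: lime_le; first by apply: is_cvg_nneseries.
  apply: nearW => N; rewrite big_mkord.
  apply: (@le_trans _ _ (\sum_(n < N)
      (phi (iter N S @^-1` D n) + (2^-1 ^+ n.+1)%:E))%E).
    by apply: lee_sum => n _; apply: (m_P n).2; exact: ltnW.
  rewrite big_split/= sumEFin sum_halves; apply: leeD; last first.
    by rewrite lee_fin gerBl exprn_ge0// invr_ge0.
  rewrite -(@measure_bigsetU_ord _ _ _ phi N predT
    (fun n : 'I_N => iter N S @^-1` D n)).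
  + apply: le_measure; rewrite ?inE//; apply: bigsetU_measurable => n _.
    apply: mD; exact: ltnW.
  + by move=> n; apply: mD; exact: ltnW.
  + apply/trivIsetP => i j _ _ ij; rewrite -preimage_setI.
    by move/trivIsetP: (trivIset_seqDU A) => ->//; rewrite preimage_set0.
Qed.

End covers.

(** * Application to the functionals [J], [Pi] and [Theta] *)

Lemma cvg_near_EFin {R : realType} {T : Type} (E : set_system T) {FE : Filter E}
    (F : T -> \bar R) (k : T -> R) (l : R) :
  (\forall x \near E, F x = (k x)%:E) -> k x @[x --> E] --> l ->
  F x @[x --> E] --> l%:E.
Proof.
move=> Fk kl; apply/fine_cvgP; split; first by apply: filterS Fk => x ->.
by apply: cvg_trans kl; apply: near_eq_cvg; apply: filterS Fk => x /= ->.
Qed.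

Section functionals.
Context {d} {X : measurableType d} {R : realType} {S : X -> X}.
Context (bijS : bijective S).
Context (phi0 Lambda : {finite_measure set (space0 S) -> \bar R}).
Context (invL : forall B : set (space0 S), measurable B ->
  Lambda (S @^-1` B) = Lambda B).
Context (Z : space0 S -> R) (dZ : is_density Lambda phi0 Z) (Q : set X).

Let shift_sum_ge0 (mu : {finite_measure set (space0 S) -> \bar R}) A :
  (0 <= shift_sum S mu A)%E.
Proof. by rewrite shift_sumE; exact: nneseries_ge0. Qed.

Let Lambda_ext_fin : Lambda_ext Lambda Q \is a fin_num.
Proof.
rewrite ge0_fin_numE; last by apply/ereal_infP => _ [A _ <-].
pose A n : set X := if n is 0 then setT else set0.
apply: (@le_lt_trans _ _ (Lambda setT)); last first.
  by rewrite -ge0_fin_numE// fin_num_measure.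
apply: ereal_inf_lbound; exists A.
  split; last by move=> x _; exists 0%N.
  by move=> [|n]; apply/(pastE bijS); [exact: measurableT|exact: measurable0].
rewrite shift_sumE (@nneseriesD1 _ _ 0%N)//= eseries0 ?adde0// => -[//|n] _ _.
by rewrite preimage_set0 measure0.
Qed.

Let C1_neq0 e : 0 < e -> C1 Lambda e Q !=set0.
Proof.
move=> e0; have : (Lambda_ext Lambda Q < Lambda_ext Lambda Q + e%:E)%E.
  by rewrite lteDl.
by rewrite {1}/Lambda_ext => /ereal_inf_lt[_ [A QA <-] lA]; exists A.
Qed.

Let C1_sub r s : 0 < r -> r <= s -> C1 Lambda r Q `<=` C1 Lambda s Q.
Proof.
move=> r0 rs A [QA lA]; split=> //; apply: lt_le_trans lA _.
by rewrite leeD2l// lee_fin.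
Qed.

Let inf_C1 e := ereal_inf [set shift_sum S phi0 A | A in C1 Lambda e Q].

Let inf_C1_ge0 e : (0 <= inf_C1 e)%E.
Proof. by apply/ereal_infP => _ [A _ <-]. Qed.

(** Replacing a cover by that of [bounded_cover] does not leave the class [C1], since the
    [Lambda]-cost does not grow. *)
Let inf_C1_le e : 0 < e -> (inf_C1 e <= phi0 setT + 1)%E.
Proof.
move=> e0; have [A [QA lA]] := C1_neq0 _ e0.
have [A' [QA' lA' pA']] := bounded_cover bijS Q phi0 Lambda A invL QA.
apply: le_trans pA'; apply: ereal_inf_lbound; exists A' => //.
by split=> //; exact: le_lt_trans lA' lA.
Qed.

(** [inf_C1] grows as [e] decreases, so its limit at 0 is its supremum over []0, 1]], bounded by
    [phi0 setT + 1]. *)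
Let PhiLambdaP : PhiLambda phi0 Lambda Q \is a fin_num /\
  forall e, 0 < e -> e <= 1 -> (inf_C1 e <= PhiLambda phi0 Lambda Q)%E.
Proof.
have := @nonincreasing_at_right_cvge R inf_C1 0 (BRight 1).
rewrite bnd_simp ltr01 => /(_ isT).
have ni : {in `]0%R, 1%R] &, {homo inf_C1 : x y / x <= y >-> (y <= x)%E}}.
  move=> x y; rewrite !in_itv/= => /andP[x0 _] _ xy.
  by apply: le_ereal_inf => _ [A CA <-]; exists A => //; exact: C1_sub CA.
move=> /(_ ni) /(cvg_lim (@ereal_hausdorff R)).
rewrite -/(PhiLambda phi0 Lambda Q) => ->; split=> [|e e0 e1]; last first.
  by apply: ereal_sup_ubound; exists e => //=; rewrite in_itv/= e0.
rewrite ge0_fin_numE; last first.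
  apply: le_trans (inf_C1_ge0 1) _; apply: ereal_sup_ubound; exists 1 => //=.
  by rewrite in_itv/= ltr01 lexx.
apply: (@le_lt_trans _ _ (phi0 setT + 1)%E); last first.
  by rewrite -ge0_fin_numE ?adde_ge0// fin_numD fin_num_measure.
apply: ge_ereal_sup => y [e /=]; rewrite in_itv/= => /andP[e0 _] <-.
exact: inf_C1_le.
Qed.

Let G e := C01 phi0 Lambda e Q.

Let G_sub r s : 0 < r -> r <= s -> G r `<=` G s.
Proof.
move=> r0 rs A [QA lA]; split=> //; first exact: C1_sub QA.
by apply: lt_le_trans lA _; rewrite leeD2l// lee_fin.
Qed.

Let G_neq0 r : 0 < r -> G r !=set0.
Proof.
move=> r0; have [Pfin Pge] := PhiLambdaP; pose s := Num.min r 1.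
have s0 : 0 < s by rewrite lt_min r0 ltr01.
have [sr s1] : s <= r /\ s <= 1 by split; rewrite ge_min lexx ?orbT.
have : (inf_C1 s < PhiLambda phi0 Lambda Q + s%:E)%E.
  by apply: le_lt_trans (Pge _ s0 s1) _; rewrite lteDl.
move=> /ereal_inf_lt[_ [A CA <-] pA].
by exists A; apply: G_sub sr _ _ => //; split.
Qed.

Let level (A : nat -> set X) n : set (space0 S) := iter n S @^-1` A n.
(** Covers in [G 1] exceed each of the two limiting costs by less than 1, whence the term 2. *)
Let M := fine (PhiLambda phi0 Lambda Q) + fine (Lambda_ext Lambda Q) + 2.

Let G1P A : G 1 A -> (forall n, measurable (level A n)) /\
  (\sum_(0 <= n <oo) phi0 (level A n) + \sum_(0 <= n <oo) Lambda (level A n)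
    <= M%:E)%E.
Proof.
move=> [[[pA _] lA] phA]; split; first by move=> n; exact/(pastE bijS).
have [Pfin _] := PhiLambdaP.
rewrite shift_sumE in lA; rewrite shift_sumE in phA.
rewrite (_ : M = fine (PhiLambda phi0 Lambda Q) + 1 +
  (fine (Lambda_ext Lambda Q) + 1)); last by rewrite /M; ring.
by rewrite 3!EFinD !fineK// leeD// ltW.
Qed.

Let f x A := series_int phi0 (level A) (fun z => Z z `^ x).
Let g x A := series_int phi0 (level A) (fun z => Z z `^ x * ln (Z z)).

Let Z_ge0 z : 0 <= Z z. Proof. by have [_ + _] := dZ. Qed.
Let mZ : measurable_fun [set: space0 S] Z. Proof. by have [] := dZ. Qed.

Let mpow x : measurable_fun [set: space0 S] (fun z => Z z `^ x).
Proof. exact: measurableT_comp (measurable_powR x) mZ. Qed.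

Let dom_pow x : 0 <= x <= 1 -> dominated Z 1 (fun z => Z z `^ x).
Proof. by move=> x01; split => // z; rewrite mul1r powR_le1D. Qed.

Let dom_powlog a b x : 0 < a -> b < 1 -> a <= x <= b ->
  dominated Z (1 + (2 / a ^+ 2 + 2 / (1 - b) ^+ 2))
    (fun z => Z z `^ x * ln (Z z)).
Proof.
move=> a0 b1 xab; split.
- by rewrite !addr_ge0// divr_ge0// exprn_ge0//; lra.
- by apply: measurable_funM => //; exact: measurableT_comp (@measurable_ln R) mZ.
- by move=> z; exact: powR_ln_le.
Qed.

Let dom_1DZ : dominated Z 1 (fun z => 1 + Z z).
Proof.
split=> //; first exact: measurable_funD.
by move=> z; rewrite mul1r ger0_norm// addr_ge0.
Qed.

Let pow_sumE A x : G 1 A -> 0 < x < 1 ->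
  pow_sum phi0 Z x A = (f x A)%:E /\ `|f x A| <= M.
Proof.
move=> GA /andP[x0 x1]; have [mA AM] := G1P _ GA.
have dx : dominated Z 1 (fun z => Z z `^ x) by apply: dom_pow; rewrite !ltW.
split; last by have := norm_series_int_le _ _ _ dZ _ mA _ AM _ _ dx; rewrite mul1r.
by rewrite /pow_sum shift_sumE (eseries_int _ _ _ dZ _ mA _ AM _ _ dx).
Qed.

Let powlog_sumE A x : G 1 A -> 0 < x < 1 ->
  powlog_sum phi0 Z x A = (g x A)%:E /\
  `|g x A| <= (1 + (2 / x ^+ 2 + 2 / (1 - x) ^+ 2)) * M.
Proof.
move=> GA /andP[x0 x1]; have [mA AM] := G1P _ GA.
have dx := dom_powlog x x x x0 x1 ltac:(lra).
split; last exact: norm_series_int_le _ _ _ dZ _ mA _ AM _ _ dx.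
by rewrite /powlog_sum shift_sumE (eseries_int _ _ _ dZ _ mA _ AM _ _ dx).
Qed.

Let tangent A x y : G 1 A -> 0 < x < 1 -> 0 < y < 1 ->
  f x A + (y - x) * g x A <= f y A.
Proof.
move=> GA /andP[x0 x1] /andP[y0 y1]; have [mA AM] := G1P _ GA.
have dg := dom_powlog x x x x0 x1 ltac:(lra).
have dx : dominated Z 1 (fun z => Z z `^ x) by apply: dom_pow; rewrite !ltW.
have dy : dominated Z 1 (fun z => Z z `^ y) by apply: dom_pow; rewrite !ltW.
(* The tangent inequality is rearranged with the power of exponent [x] alone on the left; the second
   coefficient is 0. *)
have := series_int_le_comb _ _ _ dZ _ mA _ AM _ _ _ _ (- (y - x)) 0 _ _ _ _
  dx dy dg dx.
rewrite mul0r addr0 mulNr -lerBlDr opprK; apply => z.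
by rewrite mul0r addr0 mulNr -lerBlDr opprK powR_tangent.
Qed.

Let taylor a b : 0 < a -> a < b -> b < 1 -> exists2 K, 0 < K &
  forall A x y, G 1 A -> a <= x <= b -> a <= y <= b ->
    f y A <= f x A + (y - x) * g x A + K * (y - x) ^+ 2 /\ `|g x A| <= K.
Proof.
move=> a0 ab b1; pose C := 2 / a ^+ 2 + 2 / (1 - b) ^+ 2.
have C0 : 0 <= C by rewrite addr_ge0// divr_ge0// exprn_ge0//; lra.
have M0 : 0 <= M.
  have [A GA] := G_neq0 1 ltr01; have [mA AM] := G1P _ GA.
  have := norm_series_int_le _ _ _ dZ _ mA _ AM _ _ dom_1DZ.
  by rewrite mul1r; exact: le_trans.
have CM0 : 0 <= C * M by exact: mulr_ge0.
(* One constant serves for the remainder, through [2 * C * M], and for [g], through [(1 + C) * M];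
   the 1 makes it positive. *)
pose K := 2 * C * M + (1 + C) * M + 1.
have [K0 [KC K2]] : 0 < K /\ ((1 + C) * M <= K /\ 2 * (C * M) <= K).
  by rewrite /K; move: (M) M0 CM0 => N; nra.
exists K => //.
move=> A x y GA xab yab; have [mA AM] := G1P _ GA.
have dg := dom_powlog a b x a0 b1 xab; rewrite -/C in dg.
have dx : dominated Z 1 (fun z => Z z `^ x) by apply: dom_pow; lra.
have dy : dominated Z 1 (fun z => Z z `^ y) by apply: dom_pow; lra.
have gK : `|g x A| <= (1 + C) * M.
  exact: norm_series_int_le _ _ _ dZ _ mA _ AM _ _ dg.
split; last exact: le_trans KC.
(* The pointwise remainder is a multiple of [1 + Z], whose summed integral is at most [M] for every
   cover in [G 1]. *)
have le := series_int_le_comb _ _ _ dZ _ mA _ AM _ _ _ _ (y - x)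
  (2 * C * (y - x) ^+ 2) _ _ _ _ dy dx dg dom_1DZ.
apply: le_trans (le _) _ => [z|].
  have := powR_taylor a b (Z z) x y (Z_ge0 z) a0 b1 xab yab; rewrite -/C.
  by rewrite [2 * C * (1 + Z z) * _]mulrAC.
rewrite -/(f x A) -/(g x A) lerD2l.
have : `|series_int phi0 (level A) (fun z => 1 + Z z)| <= 1 * M.
  exact: norm_series_int_le _ _ _ dZ _ mA _ AM _ _ dom_1DZ.
rewrite mul1r ler_norml => /andP[_]; set I := series_int _ _ _ => IM.
have h0 : 0 <= (y - x) ^+ 2 by exact: sqr_ge0.
have CI : C * I <= C * M by rewrite ler_wpM2l.
rewrite [leLHS](_ : _ = (2 * (C * I)) * (y - x) ^+ 2); last by ring.
by rewrite ler_wpM2r// (le_trans _ K2)// ler_pM2l.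
Qed.

Let Jr x := fine (J phi0 Lambda Z x Q).
Let Pr x := fine (Pi phi0 Lambda Z x Q).
Let Tr x := fine (Theta phi0 Lambda Z x Q).
Let F x r : set (nat -> set X) := [set A | G r A /\ Jr x - r < f x A].

Let J_limsup x : 0 < x < 1 ->
  J phi0 Lambda Z x Q = (Jr x)%:E /\ is_limsup G (f x) (Jr x).
Proof.
move=> x01; have [|l] := cvg_ereal_sup_family G (pow_sum phi0 Z x) (f x) M G_sub G_neq0.
  by move=> A GA; exact: pow_sumE.
move=> /(cvg_lim (@ereal_hausdorff R)); rewrite -/(J phi0 Lambda Z x Q).
by rewrite /Jr => ->.
Qed.

Let F_sub x r s : 0 < r -> r <= s -> F x r `<=` F x s.
Proof. by move=> r0 rs A [GA fA]; split; [exact: G_sub GA|apply: le_lt_trans fA; rewrite lerB]. Qed.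

Let F_neq0 x : 0 < x < 1 -> forall r, 0 < r -> F x r !=set0.
Proof.
move=> x01 r r0; have [_ [_ fJ]] := J_limsup x x01.
by have [A GA fA] := fJ r r r0 r0; exists A.
Qed.

(** For [r <= 1] the covers lie in [G 1], where [pow_sum] is finite and equal to [f]. This is enough
    for limits as [r] decreases to 0. *)
Let F01E x r : 0 < x < 1 -> 0 < r -> r <= 1 -> F01 phi0 Lambda Z x r Q = F x r.
Proof.
move=> x01 r0 r1; have [JE _] := J_limsup x x01.
apply/seteqP; split=> A [GA fA]; split=> //; move: fA;
  have [fE _] := pow_sumE A x (G_sub _ _ r0 r1 _ GA) x01;
  by rewrite /= JE fE -EFinB lte_fin.
Qed.

Let Pi_limsup x : 0 < x < 1 ->
  Pi phi0 Lambda Z x Q = (Pr x)%:E /\ is_limsup (F x) (g x) (Pr x).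
Proof.
move=> x01; have [|l] := cvg_ereal_sup_family (F x) (powlog_sum phi0 Z x) (g x)
  ((1 + (2 / x ^+ 2 + 2 / (1 - x) ^+ 2)) * M) (F_sub x) (F_neq0 x x01).
  by move=> A [GA _]; exact: powlog_sumE.
move=> Fl gl; suff PE : Pi phi0 Lambda Z x Q = l%:E by rewrite /Pr PE.
apply/(cvg_lim (@ereal_hausdorff R)); apply: cvg_trans Fl; apply: near_eq_cvg.
near=> r; rewrite F01E//; near: r; exact: nbhs_right_ltW.
Unshelve. all: by end_near. Qed.

Let Theta_liminf x : 0 < x < 1 -> Theta phi0 Lambda Z x Q = (Tr x)%:E /\
  is_limsup (F x) (fun A => - g x A) (- Tr x).
Proof.
move=> x01; have [|l] := cvg_ereal_inf_family (F x) (powlog_sum phi0 Z x) (g x)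
  ((1 + (2 / x ^+ 2 + 2 / (1 - x) ^+ 2)) * M) (F_sub x) (F_neq0 x x01).
  by move=> A [GA _]; exact: powlog_sumE.
move=> Fl gl; suff TE : Theta phi0 Lambda Z x Q = l%:E by rewrite /Tr TE.
apply/(cvg_lim (@ereal_hausdorff R)); apply: cvg_trans Fl; apply: near_eq_cvg.
near=> r; rewrite F01E//; near: r; exact: nbhs_right_ltW.
Unshelve. all: by end_near. Qed.

Let derivatives := @envelope_derivatives R _ G f g Jr Pr Tr 0 1 G_sub
  tangent taylor (fun x x01 => (J_limsup x x01).2)
  (fun x x01 => (Pi_limsup x x01).2) (fun x x01 => (Theta_liminf x x01).2).

Lemma J_derivatives x : 0 < x < 1 ->
  [/\ is_right_derive (fun x => J phi0 Lambda Z x Q) x (Pi phi0 Lambda Z x Q),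
      Pi phi0 Lambda Z y Q @[y --> x^'+] --> Pi phi0 Lambda Z x Q,
      Theta phi0 Lambda Z y Q @[y --> x^'+] --> Pi phi0 Lambda Z x Q &
      Pi phi0 Lambda Z y Q @[y --> x^'-] --> Theta phi0 Lambda Z x Q].
Proof.
move=> x01; have /andP[x0 x1] := x01.
have [slope PR TR PL] := derivatives x x01.
(* The functionals are identified with their real versions only on []0, 1[], so the limits are
   transferred through one-sided neighbourhoods inside it. *)
have in_right : \forall y \near x^'+, 0 < y < 1.
  near=> y; apply/andP; split; last by near: y; exact: nbhs_right_lt.
  by apply: lt_trans x0 _; near: y; exact: nbhs_right_gt.
have in_left : \forall y \near x^'-, 0 < y < 1.
  near=> y; apply/andP; split; first by near: y; exact: nbhs_left_gt.
  by apply: lt_trans x1; near: y; exact: nbhs_left_lt.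
have [PE _] := Pi_limsup x x01; have [TE _] := Theta_liminf x x01.
have [JE _] := J_limsup x x01.
split; rewrite ?PE ?TE.
- split=> //; apply: cvg_near_EFin slope; near=> h.
  have h0 : 0 < h by near: h; exact: nbhs_right_gt.
  have hx : h < 1 - x by near: h; apply: nbhs_right_lt; rewrite subr_gt0.
  have [-> _] := J_limsup (x + h) ltac:(lra).
  by rewrite JE -EFinB -EFinM.
- by apply: cvg_near_EFin PR; apply: filterS in_right => y /Pi_limsup[].
- by apply: cvg_near_EFin TR; apply: filterS in_right => y /Theta_liminf[].
- by apply: cvg_near_EFin PL; apply: filterS in_left => y /Pi_limsup[].
Unshelve. all: by end_near. Qed.

End functionals.

Theorem theorem8 (d : measure_display) (X : measurableType d) (R : realType)
  (S : X -> X) (hS : bijective S)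
  (phi0 Lambda : {finite_measure set (space0 S) -> \bar R})
  (hinv : forall B : set (space0 S), measurable B ->
            Lambda (S @^-1` B) = Lambda B)
  (hac : Lambda `<< phi0)
  (Z : space0 S -> R) (hZ : is_density Lambda phi0 Z)
  (Q : set X) (hQ : calB S Q)
  (alpha : R) (halpha : 0 < alpha < 1) :
  [/\ is_right_derive (fun x => J phi0 Lambda Z x Q) alpha
        (Pi phi0 Lambda Z alpha Q),
      Pi phi0 Lambda Z x Q @[x --> alpha^'+] --> Pi phi0 Lambda Z alpha Q,
      Theta phi0 Lambda Z x Q @[x --> alpha^'+] --> Pi phi0 Lambda Z alpha Q &
      Pi phi0 Lambda Z x Q @[x --> alpha^'-] --> Theta phi0 Lambda Z alpha Q].
Proof. exact: (@J_derivatives d X R S hS phi0 Lambda hinv Z hZ Q alpha halpha). Qed.
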